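(* Let $(X,\mathcal{T})$ be an infra topological space and let $A\subseteq X$. Then $A$ is infra $e$-open if and only if $A=\delta\mathrm{PInt}(A)\cup \delta\mathrm{SInt}(A)$.
   Context: An infra topological space $(X,\mathcal{T})$ is a set $X$ with a family $\mathcal{T}$ of subsets of $X$ such that $\emptyset,X\in\mathcal{T}$ and $\mathcal{T}$ is closed under finite intersections (closure under unions is not required). Members of $\mathcal{T}$ are called infra open; their complements are infra closed. For $A\subseteq X$: $\mathrm{Int}(A)=\bigcup\{O: O\subseteq A,\ O\in\mathcal{T}\}$ and $\mathrm{Cl}(A)=\bigcap\{C: A\subseteq C,\ X\setminus C\in\mathcal{T}\}$. A set $A$ is infra regular open if $A=\mathrm{Int}(\mathrm{Cl}(A))$. Put $\mathrm{Int}_\delta(A)=\bigcup\{O: O\subseteq A,\ O \text{ infra regular open}\}$ and $\mathrm{Cl}_\delta(A)=\bigcap\{C: A\subseteq C,\ X\setminus C \text{ infra regular open}\}$. A set $A$ is infra $e$-open if $A\subseteq \mathrm{Cl}(\mathrm{Int}_\delta(A))\cup \mathrm{Int}(\mathrm{Cl}_\delta(A))$; infra $\delta$-preopen if $A\subseteq \mathrm{Int}(\mathrm{Cl}_\delta(A))$; infra $\delta$-semiopen if $A\subseteq \mathrm{Cl}(\mathrm{Int}_\delta(A))$. $\delta\mathrm{PInt}(A)$ (resp. $\delta\mathrm{SInt}(A)$) is the union of all infra $\delta$-preopen (resp. infra $\delta$-semiopen) sets contained in $A$. *)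

(* Defs.v *)
From mathcomp Require Import all_boot.
From mathcomp Require Import boolp classical_sets.

Set Implicit Arguments.
Unset Strict Implicit.
Unset Printing Implicit Defensive.

Local Open Scope classical_set_scope.

(* [setI_closed T] is closure under binary intersections; together with
   [T setT] (the empty intersection) it gives all finite ones. *)
Definition infra_topology (X : Type) (T : set (set X)) : Prop :=
  [/\ T set0, T setT & setI_closed T].

Section InfraTopology.
Variables (X : Type) (T : set (set X)).
Implicit Types A : set X.

Definition infra_open A : Prop := T A.
Definition infra_closed A : Prop := infra_open (~` A).

(* As T need not be closed under unions, [Int A] need not be infra open and
   [Cl A] need not be infra closed; likewise for the delta versions. *)
Definition Int A : set X :=
  \bigcup_(O in [set O | O `<=` A /\ infra_open O]) O.
Definition Cl A : set X :=
  \bigcap_(C in [set C | A `<=` C /\ infra_closed C]) C.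

Definition infra_regular_open A : Prop := A = Int (Cl A).

Definition Int_delta A : set X :=
  \bigcup_(O in [set O | O `<=` A /\ infra_regular_open O]) O.
Definition Cl_delta A : set X :=
  \bigcap_(C in [set C | A `<=` C /\ infra_regular_open (~` C)]) C.

Definition infra_e_open A : Prop :=
  A `<=` Cl (Int_delta A) `|` Int (Cl_delta A).
Definition infra_delta_preopen A : Prop := A `<=` Int (Cl_delta A).
Definition infra_delta_semiopen A : Prop := A `<=` Cl (Int_delta A).

Definition deltaPInt A : set X :=
  \bigcup_(O in [set O | infra_delta_preopen O /\ O `<=` A]) O.
Definition deltaSInt A : set X :=
  \bigcup_(O in [set O | infra_delta_semiopen O /\ O `<=` A]) O.

End InfraTopology.

(* Main.v *)
(** If [A] is infra e-open then [A `&` Int (Cl_delta A)] is delta-preopen and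
    [A `&` Cl (Int_delta A)] is delta-semiopen, and these two sets cover [A].
    Delta-preopenness uses that [Int (Cl O)] is infra regular open, that infra
    regular open sets are stable under intersection, and that [Cl_delta A] is a
    fixed point of [Cl], none of which requires [Int] to yield open sets. *)
Require Import Defs.
From mathcomp Require Import all_boot.
From mathcomp Require Import boolp classical_sets.

Local Open Scope classical_set_scope.

Section InfraOperators.
Set Implicit Arguments.
Unset Strict Implicit.
Context {X : Type} (T : set (set X)).
Implicit Types A B O : set X.

Lemma Int_mono A B : A `<=` B -> Int T A `<=` Int T B.
Proof.
by move=> AB x [O [OA oO] Ox]; exists O => //; split=> // y /OA /AB.
Qed.

Lemma Int_sub A : Int T A `<=` A.
Proof. by move=> x [O [OA _] /OA]. Qed.

Lemma open_sub_Int O A : infra_open T O -> O `<=` A -> O `<=` Int T A.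
Proof. by move=> oO OA x Ox; exists O. Qed.

Lemma Int_idem A : Int T (Int T A) = Int T A.
Proof.
apply/seteqP; split; first exact: Int_sub.
by move=> x [O [OA oO] Ox]; exists O => //; split=> //; exact: open_sub_Int.
Qed.

Lemma IntI A B : setI_closed T -> Int T (A `&` B) = Int T A `&` Int T B.
Proof.
move=> TI; apply/seteqP; split.
  by move=> x ABx; split; move: x ABx; apply: Int_mono => y [].
move=> x [[O [OA oO] Ox] [V [VB oV] Vx]]; exists (O `&` V) => //.
by split; [move=> y [/OA Ay /VB By] | exact: TI].
Qed.

Lemma Cl_mono A B : A `<=` B -> Cl T A `<=` Cl T B.
Proof. by move=> AB x Ax C [BC cC]; apply: Ax; split=> // y /AB /BC. Qed.

Lemma sub_Cl A : A `<=` Cl T A.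
Proof. by move=> x Ax C [sAC _]; exact: sAC. Qed.

(** Every infra closed set containing [A] also contains [Cl T A], so both sides intersect the same
    family. *)
Lemma Cl_idem A : Cl T (Cl T A) = Cl T A.
Proof.
apply/seteqP; split; last exact: sub_Cl.
by move=> x Ax C [sAC cC]; apply: Ax; split=> // y; apply; split.
Qed.

Lemma regular_Int_Cl A : infra_regular_open T (Int T (Cl T A)).
Proof.
apply/seteqP; split.
  by rewrite -{1}Int_idem; apply: Int_mono; exact: sub_Cl.
by apply: Int_mono; rewrite -[X in _ `<=` X]Cl_idem; apply: Cl_mono; exact: Int_sub.
Qed.

Lemma regular_IntE A : infra_regular_open T A -> Int T A = A.
Proof. by move=> rA; rewrite [in LHS]rA Int_idem -rA. Qed.

Lemma regularI A B : setI_closed T -> infra_regular_open T A ->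
  infra_regular_open T B -> infra_regular_open T (A `&` B).
Proof.
move=> TI rA rB; apply/seteqP; split.
  (* Regular open sets are their own interiors, so [IntI] makes the intersection its own interior
     too. *)
  rewrite -{1}(regular_IntE rA) -{1}(regular_IntE rB) -IntI //.
  by apply: Int_mono; exact: sub_Cl.
move=> x ABx; rewrite rA rB.
by split; move: x ABx; apply: Int_mono; apply: Cl_mono => y [].
Qed.

Lemma Int_delta_mono A B : A `<=` B -> Int_delta T A `<=` Int_delta T B.
Proof.
by move=> AB x [O [OA rO] Ox]; exists O => //; split=> // y /OA /AB.
Qed.

Lemma Cl_delta_mono A B : A `<=` B -> Cl_delta T A `<=` Cl_delta T B.
Proof. by move=> AB x Ax C [BC rC]; apply: Ax; split=> // y /AB /BC. Qed.

(** The complement of [C], being its own interior, is a union of infra open sets [V]; the complement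
    of such a [V] is infra closed and contains [Cl_delta T A]. *)
Lemma Cl_Cl_delta A : Cl T (Cl_delta T A) `<=` Cl_delta T A.
Proof.
move=> x xA C [sAC rC]; apply: contrapT => nCx.
have [V [VC oV] Vx] : Int T (~` C) x by rewrite regular_IntE.
apply: (xA (~` V)) => //; split; last by rewrite /infra_closed setCK.
by move=> y yA /VC; apply; apply: yA.
Qed.

Lemma Int_Cl_delta_sub A : setI_closed T ->
  Int T (Cl_delta T A) `<=` Cl_delta T (A `&` Int T (Cl_delta T A)).
Proof.
move=> TI y [O [OA oO] Oy] C [BC rC]; apply: contrapT => nCy.
(* [O] may fail to be regular open, so it is enlarged to [Int T (Cl T O)]. Removing [C] leaves a
   regular open set containing [y]; since [y] is in [Cl_delta T A], it remains to see that this set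
   misses [A]. *)
have rG := regularI TI (regular_Int_Cl O) rC.
apply: (OA _ Oy (~` (Int T (Cl T O) `&` ~` C))); last first.
  by split=> //; exact: (open_sub_Int oO (@sub_Cl O)).
split; last by rewrite setCK.
(* As [Cl T O] stays inside [Cl_delta T A], a point of [A] in [Int T (Cl T O)] already lies in
   [C]. *)
move=> a Aa [Oa]; apply; apply: BC; split=> //.
by move: a Oa {Aa}; apply: Int_mono => z /(Cl_mono OA) /Cl_Cl_delta.
Qed.

Lemma deltaPIntE A : setI_closed T ->
  deltaPInt T A = A `&` Int T (Cl_delta T A).
Proof.
move=> TI; apply/seteqP; split.
  move=> x [O [pO OA] Ox]; split; first exact: OA.
  by apply: Int_mono (pO _ Ox); exact: Cl_delta_mono.
move=> x Bx; exists (A `&` Int T (Cl_delta T A)) => //; split=> [|y []//].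
move=> y [_]; rewrite -{1}Int_idem; apply: Int_mono.
exact: Int_Cl_delta_sub.
Qed.

Lemma deltaSIntE A : deltaSInt T A = A `&` Cl T (Int_delta T A).
Proof.
apply/seteqP; split.
  move=> x [O [sO OA] Ox]; split; first exact: OA.
  by apply: Cl_mono (sO _ Ox); exact: Int_delta_mono.
move=> x Bx; exists (A `&` Cl T (Int_delta T A)) => //; split=> [|y []//].
(* A regular open [O] inside [A] is part of [Int_delta T A], hence of its closure, so cutting [A]
   down to that closure loses no such [O]. *)
move=> y [_]; apply: Cl_mono => z [O [OA rO] Oz]; exists O => //; split=> //.
by move=> w Ow; split; [exact: OA | apply: sub_Cl; exists O].
Qed.

End InfraOperators.

Theorem theorem3p21 (X : Type) (T : set (set X)) (A : set X) :
  infra_topology T ->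
  (infra_e_open T A <-> A = deltaPInt T A `|` deltaSInt T A).
Proof.
move=> [_ _ TI]; rewrite deltaPIntE // deltaSIntE -setIUr setUC.
(* With [A] factored out, the equation says that [A] equals its intersection with the union defining
   e-openness, which is an inclusion. *)
by split=> [eA | /esym/setIidPl]; [rewrite (setIidPl _ _).2 | ].
Qed.
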